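(* Let $k\geqslant 0$ and $m\geqslant 0$ be integers, and let $M$ be any component whose leftmost piece is a bulb and with $\mathcal{G}(M)=\infty$. Then the concatenation $\overline{k}\,|m|\,M$ (from left to right: $k$ bulbs, then $m$ sockets, then $M$) satisfies $\mathcal{G}(\overline{k}\,|m|\,M)=\infty$.
   Context: The ruleset CHRISTMAS LIGHTS' FIXTURE. A component is a finite (possibly empty) word, read from left to right, in two kinds of pieces: bulbs and sockets. The ruleset is impartial; the moves available in a component are: (1) choose a bulb: that bulb and every piece to its right are deleted (a quiet move); (2) choose a socket that does not have bulbs as both its left and right neighbours (either neighbour is a socket or does not exist): only that socket is deleted and the two ends are joined (a quiet move); (3) choose a socket whose left and right neighbours both exist and are bulbs: only that socket is deleted, the two ends are joined, and the same player must move again, in any component of the current disjunctive sum (a carry-on move). A player who has to move and has no move loses (normal play). A disjunctive sum of components (and nim heaps) is played by moving in exactly one summand at each move, with players alternating except for carry-on moves. A $\mathcal P$-position is one that the previous player (the one not about to move) wins; an $\mathcal N$-position is one that the next player wins. Grundy-value. $\mathcal{G}(G)\in\{0,1,2,\dots\}\cup\{\infty\}$ is defined recursively. Let $S_G$ be the set of all finite Grundy-values of components reachable from $G$ by one quiet move. Let $P_G$ be the set of nonnegative integers $j$ such that some carry-on move leads from $G$ to a component $G'$ with $\mathcal{G}(G')\neq j$ (so $\mathcal G(G')=\infty$ protects every $j$). Then $\mathcal{G}(G)=\operatorname{mex}(S_G\cup P_G)$, the least nonnegative integer not in $S_G\cup P_G$, and $\mathcal{G}(G)=\infty$ if $S_G\cup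 P_G$ contains all nonnegative integers. Equivalently, $\mathcal{G}(G)=n<\infty$ iff the sum of $G$ and a nim heap $*n$ of size $n$ is a $\mathcal P$-position, and $\mathcal{G}(G)=\infty$ iff there is no such $n$. A component with Grundy-value $\infty$ is said to be equal to the moon. Notation: $\overline{n}$ is a string of $n$ consecutive bulbs, $|m|$ is a string of $m$ consecutive sockets, and juxtaposition is concatenation from left to right. *)

(* Defs.v *)
From mathcomp Require Import all_boot.
From mathcomp Require Import boolp classical_sets.

Set Implicit Arguments.
Unset Strict Implicit.
Unset Printing Implicit Defensive.

Local Open Scope classical_set_scope.

Inductive piece : Type := Bulb | Socket.

Definition component : Type := seq piece.

(* The default [Socket] makes both predicates below false on the empty word,
   i.e. when the neighbour does not exist. *)
Definition ends_with_bulb (s : component) : Prop := last Socket s = Bulb.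
Definition starts_with_bulb (s : component) : Prop := head Socket s = Bulb.

Inductive quiet_move : component -> component -> Prop :=
| quiet_bulb (s t : component) : quiet_move (s ++ Bulb :: t) s
| quiet_socket (s t : component) :
    ~ (ends_with_bulb s /\ starts_with_bulb t) ->
    quiet_move (s ++ Socket :: t) (s ++ t).

Inductive carry_on_move : component -> component -> Prop :=
| carry_on_socket (s t : component) :
    ends_with_bulb s -> starts_with_bulb t ->
    carry_on_move (s ++ Socket :: t) (s ++ t).

(* Values in {0, 1, 2, ...} together with infinity (the moon). *)
Definition value : Type := option nat.
Notation finite n := (Some n : value) (only parsing).
Definition infinite : value := None.

Definition mex (A : set nat) : value :=
  if pselect (exists n, `[< ~ A n >]) is left exA
  then finite (ex_minn exA) else infinite.

Definition quiet_values (val : component -> value) (G : component) : set nat :=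
  [set j | exists2 G', quiet_move G G' & val G' = finite j].

Definition carry_on_values (val : component -> value) (G : component) :
    set nat :=
  [set j | exists2 G', carry_on_move G G' & val G' <> finite j].

(* Recursion on a bound for the size of the component.  The value at bound 0 is
   never used by [grundy], since every move removes a piece; [grundyE] is the
   defining recursion. *)
Fixpoint grundy_rec (n : nat) (G : component) : value :=
  if n is n'.+1 then
    mex (quiet_values (grundy_rec n') G `|` carry_on_values (grundy_rec n') G)
  else infinite.

Definition grundy (G : component) : value := grundy_rec (size G).+1 G.

Lemma mex_finiteP (A : set nat) (n : nat) :
  mex A = finite n <-> ~ A n /\ (forall j, j < n -> A j).
Proof.
rewrite /mex; case: pselect => [exA|nexA]; last first.
  by split=> // -[nAn _]; case: nexA; exists n; apply/asboolP.
case: ex_minnP => m /asboolP nAm minm; split=> [[<-]|[nAn An]].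
  split=> // j ltjm; apply: contrapT => nAj.
  by have := minm j (introT (asboolP _) nAj); rewrite leqNgt ltjm.
congr Some; apply/eqP; rewrite eqn_leq minm; last exact/asboolP.
by rewrite leqNgt; apply/negP => /An.
Qed.

Lemma mex_infiniteP (A : set nat) : mex A = infinite <-> forall n, A n.
Proof.
rewrite /mex; case: pselect => [exA|nexA]; split => //.
  by move=> allA; exfalso; case: exA => m /asboolP; apply.
by move=> _ n; apply: contrapT => nAn; apply: nexA; exists n; apply/asboolP.
Qed.

Lemma quiet_move_size (G G' : component) : quiet_move G G' -> size G' < size G.
Proof. by case=> s t *; rewrite !size_cat /= addnS ltnS ?leq_addr. Qed.

Lemma carry_on_move_size (G G' : component) :
  carry_on_move G G' -> size G' < size G.
Proof. by case=> s t *; rewrite !size_cat /= addnS ltnS. Qed.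

Lemma grundy_recE (n : nat) (G : component) :
  size G < n -> grundy_rec n G = grundy G.
Proof.
rewrite /grundy; have [k] := ubnP (size G).
elim: k n G => // k IHk [//|n] G ltGk ltGn /=.
have eqv G' : size G' < size G -> grundy_rec n G' = grundy_rec (size G) G'.
  move=> ltG'; have ltG'k := leq_trans ltG' ltGk.
  by rewrite (IHk n) ?(IHk (size G)) //; apply: leq_trans ltG' _.
congr (mex (_ `|` _)); apply/seteqP; split=> j /= [G' mv vG'];
  exists G' => //; move: vG'; rewrite eqv //;
  by [apply: quiet_move_size | apply: carry_on_move_size].
Qed.

Lemma grundyE (G : component) :
  grundy G = mex (quiet_values grundy G `|` carry_on_values grundy G).
Proof.
rewrite {1}/grundy /=.
congr (mex (_ `|` _)); apply/seteqP; split=> j /= [G' mv vG'];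
  exists G' => //; move: vG'; rewrite grundy_recE //;
  by [apply: quiet_move_size | apply: carry_on_move_size].
Qed.

Definition bulbs (k : nat) : component := nseq k Bulb.
Definition sockets (m : nat) : component := nseq m Socket.

(* Main.v *)
(** Let M be empty or begin with a bulb.  Every socket of M then keeps its left
    neighbour when k bulbs and m sockets are put in front, so the moves of the
    concatenation are those inside M, those to fewer than k bulbs, and the
    deletion of one of the m sockets.  By induction on the number of pieces,
    the Grundy-value of the concatenation is a function of k, m and the
    Grundy-value j of M, with infinity sent to infinity: for k, m > 0 it is
    infinite when m = j = 1, where the carry-on move joining the bulbs protects
    every value but k + 1 and the quiet move deleting all of M attains k + 1.
    Otherwise it is k + j', with j' either j or the nim-sum of j and 1. *)

Require Import Defs.
From mathcomp Require Import all_boot.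
From mathcomp Require Import zify.

Set Implicit Arguments.
Unset Strict Implicit.
Unset Printing Implicit Defensive.

(** * Options of a concatenation *)

Definition reaches (G : component) (n : nat) : Prop :=
  (exists2 G', quiet_move G G' & grundy G' = finite n) \/
  (exists2 G', carry_on_move G G' & grundy G' <> finite n).

Lemma grundy_finiteP (G : component) (n : nat) :
  grundy G = finite n <-> ~ reaches G n /\ (forall j, j < n -> reaches G j).
Proof. by rewrite grundyE; exact: mex_finiteP. Qed.

Lemma grundy_infiniteP (G : component) :
  grundy G = infinite <-> forall n, reaches G n.
Proof. by rewrite grundyE; exact: mex_infiniteP. Qed.

Definition bulb_headed (M : component) : Prop := nilp M \/ starts_with_bulb M.

Lemma quiet_move_inv (G G' : component) : quiet_move G G' ->
  (exists s t, G = s ++ Bulb :: t /\ G' = s) \/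
  (exists s t, [/\ G = s ++ Socket :: t, G' = s ++ t &
                   ~ (ends_with_bulb s /\ starts_with_bulb t)]).
Proof. by case=> [s t|s t nc]; [left|right]; exists s, t. Qed.

Lemma carry_on_move_inv (G G' : component) : carry_on_move G G' ->
  exists s t, [/\ G = s ++ Socket :: t, G' = s ++ t,
                  ends_with_bulb s & starts_with_bulb t].
Proof. by case=> s t; exists s, t. Qed.

Lemma bulb_headed_quiet (M M' : component) :
  bulb_headed M -> quiet_move M M' -> bulb_headed M'.
Proof.
move=> hM /quiet_move_inv [[s [t [eM ->]]]|[s [t [eM -> _]]]];
  by move: hM; rewrite eM; case: s {eM} => [|c s] [] //; (try by left); right.
Qed.

Lemma bulb_headed_carry_on (M M' : component) :
  bulb_headed M -> carry_on_move M M' -> bulb_headed M'.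
Proof.
move=> hM /carry_on_move_inv [s [t [eM -> _ _]]].
by move: hM; rewrite eM; case: s {eM} => [|c s] [] //; right.
Qed.

Lemma bulbs_sockets_cat_inv (k m : nat) (M s t : component) (c : piece) :
  bulbs k ++ sockets m ++ M = s ++ c :: t ->
  [\/ c = Bulb /\ exists2 i, i < k & s = bulbs i,
      c = Socket /\ exists a b, [/\ m = a + b.+1, s = bulbs k ++ sockets a &
                                    t = sockets b ++ M] |
      exists2 s', s = bulbs k ++ sockets m ++ s' & M = s' ++ c :: t].
Proof.
elim: k s => [|k IHk] s /=.
  elim: m s => [|m IHm] s /=; first by move=> ->; apply: Or33; exists s.
  case: s => [[<- <-]|d s [<- /IHm]] /=.
    by apply: Or32; split=> //; exists 0, m.
  case=> [[_ [i]] //|[-> [a [b [-> -> ->]]]]|[s' -> ->]].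
    by apply: Or32; split=> //; exists a.+1, b.
  by apply: Or33; exists s'.
case: s => [[<- _]|d s [<- /IHk]] /=.
  by apply: Or31; split=> //; exists 0.
case=> [[-> [i ik ->]]|[-> [a [b [-> -> ->]]]]|[s' -> ->]].
- by apply: Or31; split=> //; exists i.+1.
- by apply: Or32; split=> //; exists a, b.
- by apply: Or33; exists s'.
Qed.

Lemma ends_with_bulb_bulbs_sockets (k a : nat) :
  ends_with_bulb (bulbs k ++ sockets a) <-> 0 < k /\ a = 0.
Proof.
rewrite /ends_with_bulb last_cat; case: a => [|a] /=.
  case: k => [|k] /=; first by split=> // -[].
  by split=> // _; elim: k.
by split=> [|[]//]; have -> : last Socket (sockets a) = Socket by elim: a.
Qed.

Lemma starts_with_bulb_sockets (b : nat) (M : component) :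
  starts_with_bulb (sockets b ++ M) <-> b = 0 /\ starts_with_bulb M.
Proof. by case: b => [|b] /=; split=> // -[]. Qed.

(** A socket is never the first piece here, so [s] is nonempty and the prefix [p] does not affect
    which piece stands to the left of that socket. *)
Lemma ends_with_bulb_cat (p s t : component) :
  bulb_headed (s ++ Socket :: t) ->
  ends_with_bulb (p ++ s) <-> ends_with_bulb s.
Proof. by case: s => [[]|d s _] //; rewrite /ends_with_bulb last_cat. Qed.

Lemma starts_with_bulb_nilp (M : component) :
  bulb_headed M -> starts_with_bulb M <-> ~~ nilp M.
Proof. by case: M => [|c M] [] //; split. Qed.

Lemma sockets_cat (a b : nat) (M : component) :
  sockets a ++ sockets b ++ M = sockets (a + b) ++ M.
Proof. by rewrite catA /sockets -nseqD. Qed.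

(** All [m] sockets of the block give the same word when deleted. That deletion is a carry-on move
    only for a lone socket with a bulb on both sides, which is what the [if] tests. Moves inside [M]
    keep their kind. *)
Lemma reaches_bulbs_sockets (k m : nat) (M : component) (n : nat) :
  bulb_headed M ->
  reaches (bulbs k ++ sockets m ++ M) n <->
  [\/ exists2 i, i < k & grundy (bulbs i) = finite n,
      0 < m /\ (if [&& 0 < k, m == 1 & ~~ nilp M]
                then grundy (bulbs k ++ sockets m.-1 ++ M) <> finite n
                else grundy (bulbs k ++ sockets m.-1 ++ M) = finite n),
      exists2 M', quiet_move M M' &
        grundy (bulbs k ++ sockets m ++ M') = finite n |
      exists2 M', carry_on_move M M' &
        grundy (bulbs k ++ sockets m ++ M') <> finite n].
Proof.
move=> hM; split.
  case=> [[G' /quiet_move_inv [[s [t [eG ->]]]|[s [t [eG -> nc]]]] vG]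
         |[G' /carry_on_move_inv [s [t [eG -> es st]]] vG]].
  - case: (bulbs_sockets_cat_inv eG) => [[_ [i ik es]]|[//]|[s' es eM]].
      by apply: Or41; exists i; rewrite -?es.
    apply: Or43; exists s'; last by rewrite -es.
    by rewrite eM; exact: quiet_bulb.
  - case: (bulbs_sockets_cat_inv eG)
      => [[//]|[_ [a [b [em es et]]]]|[s' es eM]].
      apply: Or42; split; first by lia.
      move: nc vG; rewrite es et -catA sockets_cat => nc vG.
      have -> : m.-1 = a + b by lia.
      case: ifP => // /and3P [k0 /eqP m1 nM]; case: nc.
      split; first by apply/ends_with_bulb_bulbs_sockets; split=> //; lia.
      apply/starts_with_bulb_sockets; split; first by lia.
      exact/starts_with_bulb_nilp.
    apply: Or43; exists (s' ++ t); last by move: vG; rewrite es -!catA.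
    rewrite eM; apply: quiet_socket; move: nc; rewrite es catA => nc [e1 e2].
    apply: nc; split=> //; apply/(@ends_with_bulb_cat _ _ t) => //.
    by rewrite -eM.
  - case: (bulbs_sockets_cat_inv eG)
      => [[//]|[_ [a [b [em e1 e2]]]]|[s' e1 eM]].
      apply: Or42; split; first by lia.
      move: vG; rewrite e1 e2 -catA sockets_cat => vG.
      have -> : m.-1 = a + b by lia.
      move: es st; rewrite e1 e2 => /ends_with_bulb_bulbs_sockets [k0 a0].
      move=> /starts_with_bulb_sockets [b0 /starts_with_bulb_nilp nM].
      by rewrite k0 nM // em a0 b0 /=; move: vG; rewrite a0 b0.
    apply: Or44; exists (s' ++ t); last by move: vG; rewrite e1 -!catA.
    rewrite eM; apply: carry_on_socket => //.
    move: es; rewrite e1 catA => /(@ends_with_bulb_cat _ _ t); apply.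
    by rewrite -eM.
case=> [[i ik vi]|[m0 vm]|[M' mv vM]|[M' mv vM]].
- left; exists (bulbs i) => //.
  have -> : bulbs k = bulbs i ++ Bulb :: bulbs (k - i.+1).
    by rewrite -[_ :: _]/(bulbs (k - i.+1).+1) /bulbs -nseqD; congr nseq; lia.
  by rewrite -catA; exact: quiet_bulb.
- case: m m0 vm => // m _ /=; case: ifP => [/and3P [k0 /eqP [->] nM]|nc] vm.
    right; exists (bulbs k ++ M) => //=; apply: carry_on_socket.
      by rewrite -[bulbs k]cats0; apply/(ends_with_bulb_bulbs_sockets k 0).
    exact/starts_with_bulb_nilp.
  left; exists (bulbs k ++ sockets m ++ M) => //; apply: quiet_socket.
  rewrite -[bulbs k]cats0 => -[/(ends_with_bulb_bulbs_sockets k 0) [k0 _]].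
  case/starts_with_bulb_sockets => m0 /starts_with_bulb_nilp nM.
  by move: nc; rewrite k0 m0 nM.
- left; exists (bulbs k ++ sockets m ++ M') => //.
  case/quiet_move_inv: mv vM hM => [[s [t [-> ->]]]|[s [t [-> -> nc]]]] _ hM.
    by rewrite !catA; exact: quiet_bulb.
  rewrite !catA; apply: quiet_socket => -[e1 e2]; apply: nc; split=> //.
  by apply/(ends_with_bulb_cat _ hM); exact: e1.
- right; exists (bulbs k ++ sockets m ++ M') => //.
  case/carry_on_move_inv: mv vM hM => [s [t [-> -> es st]]] _ hM.
  by rewrite !catA; apply: carry_on_socket => //;
    apply/(ends_with_bulb_cat _ hM).
Qed.

(** * Arithmetic of the value function *)

(* [twist k m j] is [j] or the nim-sum of [j] and 1.  For [k = 0] the sockets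
   act as an independent nim heap of size [m mod 2]; for [k, m > 0] the values
   0 and 1 are exchanged when [m] is odd, and the pairs [{2q, 2q + 1}] with
   [0 < q] when [m] is even. *)
Definition twist (k m j : nat) : nat :=
  if odd m (+) [&& 0 < k, 0 < m & 1 < j] then
    if odd j then j.-1 else j.+1
  else j.

Definition bulbs_sockets_value (k m j : nat) : value :=
  if [&& 0 < k, m == 1 & j == 1] then infinite else finite (k + twist k m j).

(** The test deciding whether [j] is exchanged has the same outcome on both members of a pair
    [{2q, 2q + 1}]. *)
Lemma twistK (k m : nat) : ~~ ((0 < k) && (m == 1)) -> involutive (twist k m).
Proof.
move=> km j; rewrite /twist; case: (odd m); case: k km => [|k] km;
  case: m km => [|m] km //=; case: j => [|[|j]] //=; rewrite ?negbK;
  case oj: (odd j) => //=; rewrite ?negbK ?oj //=.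
all: case: j oj => [|j] //= oj; rewrite ?oj ?(negbFE oj) //=.
all: by rewrite ?negbK; case: (odd j) oj.
Qed.

(** If [j] lies in a lower pair than [g], so does its twist. Within one pair, the only failure is
    [j = g] even in an exchanged pair; passing from [m] to [m.-1] stops that exchange, so deleting a
    socket supplies [k + g]. *)
Lemma twist_below (k m g j : nat) : ~~ ((0 < k) && (m == 1)) ->
  j < twist k m g ->
  twist k m j < g \/ 0 < m /\ bulbs_sockets_value k m.-1 g = finite (k + j).
Proof.
move=> km jg; case: (ltnP (twist k m j) g) => [|gj]; [by left|right].
case: m km jg gj => [|m] km; first by rewrite /twist /= !andbF; lia.
rewrite /bulbs_sockets_value /twist => jg gj; split=> //=.
case: ifP => [/and3P [k0 /eqP m1 /eqP g1]|_].
  by move: jg gj; rewrite k0 m1 g1 /=; case: j.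
congr (Some (k + _)); move: km jg gj.
case: (boolP (odd g)) => ?; case: (boolP (odd j)) => ?.
all: case: (ltnP 1 g) => ?; case: (ltnP 1 j) => ?.
all: case: k => [|k]; case: m => [|m] //= _; first by lia.
all: by case: (odd m) => /=; lia.
Qed.

(** The pairs exchanged for [m.-1] are exactly those not exchanged for [m], so the two twists of [g]
    differ. *)
Lemma twist_pred_neq (k m g : nat) : ~~ ((0 < k) && (m == 1)) -> 0 < m ->
  bulbs_sockets_value k m.-1 g <> finite (k + twist k m g).
Proof.
case: m => // m km _; rewrite /bulbs_sockets_value /twist /=.
case: ifP => // nm1 [/addnI]; move: km nm1.
case: k => [|k]; case: m => [|m] //= _; rewrite ?addbF.
- by case: (boolP (odd g)) => ? _ /=; lia.
- by case: (odd m); case: (boolP (odd g)) => ? _ /=; lia.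
- by case: (odd m); case: (ltnP 1 g); case: (boolP (odd g)) => /= *; lia.
Qed.

(** * Grundy-values of concatenations *)

(** The last socket has no right neighbour, so deleting it is quiet and adds [k] to the values below
    [k]. This word arises both for [M] empty and when all of [M] is deleted. *)
Lemma grundy_bulbs_socket (k : nat) :
  (forall i, i <= k -> grundy (bulbs i) = finite i) ->
  grundy (bulbs k ++ sockets 1) = finite k.+1.
Proof.
move=> IH; have E n : reaches (bulbs k ++ sockets 1) n <-> n <= k.
  rewrite -[sockets 1]cats0 reaches_bulbs_sockets; last by left.
  rewrite andbF /= cats0; split=> [|nk].
    case=> [[i ik]|[_]|[M' /quiet_move_size]|[M' /carry_on_move_size]] //.
      by rewrite IH ?(ltnW ik) // => -[<-]; exact: ltnW.
    by rewrite IH // => -[<-].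
  have [->|nk'] := eqVneq n k; first by apply: Or42; rewrite IH.
  by apply: Or41; exists n; rewrite ?IH // ltn_neqAle nk' nk.
by apply/grundy_finiteP; split=> [/E|j jk]; [rewrite ltnn|apply/E].
Qed.

Lemma grundy_nil : grundy [::] = finite 0.
Proof.
by apply/grundy_finiteP; split=> // -[] [G'];
  [move/quiet_move_size | move/carry_on_move_size].
Qed.

Lemma starts_with_bulb_quiet_nil (M : component) :
  starts_with_bulb M -> quiet_move M [::].
Proof.
case: M => // c M; rewrite /starts_with_bulb /= => ->.
exact: (quiet_bulb [::]).
Qed.

Lemma starts_with_bulb_reaches0 (M : component) :
  starts_with_bulb M -> reaches M 0.
Proof.
move/starts_with_bulb_quiet_nil => mv.
by left; exists [::]; rewrite ?grundy_nil.
Qed.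

Lemma grundy_bulbs_sockets (k m : nat) (M : component) : bulb_headed M ->
  grundy (bulbs k ++ sockets m ++ M) =
  obind (bulbs_sockets_value k m) (grundy M).
Proof.
have [N] := ubnP (k + m + size M); elim: N k m M => // N IH k m M ltN hM.
(* A row of bulbs is the instance of the induction hypothesis with no sockets and empty [M]. *)
have gb i : i < k + m + size M -> grundy (bulbs i) = finite i.
  move=> ik; rewrite -[bulbs i]cats0.
  rewrite (IH i 0 [::]); [|by rewrite /=; lia|by left].
  by rewrite grundy_nil /= /bulbs_sockets_value /= andbF /twist /= andbF addn0.
have IHp : 0 < m -> grundy (bulbs k ++ sockets m.-1 ++ M) =
    obind (bulbs_sockets_value k m.-1) (grundy M).
  by move=> m0; apply: IH => //; lia.
have IHq M' : quiet_move M M' -> grundy (bulbs k ++ sockets m ++ M') =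
    obind (bulbs_sockets_value k m) (grundy M').
  move=> mv; apply: IH; last exact: bulb_headed_quiet mv.
  by have := quiet_move_size mv; lia.
have IHc M' : carry_on_move M M' -> grundy (bulbs k ++ sockets m ++ M') =
    obind (bulbs_sockets_value k m) (grundy M').
  move=> mv; apply: IH; last exact: bulb_headed_carry_on mv.
  by have := carry_on_move_size mv; lia.
have low n : n < k -> reaches (bulbs k ++ sockets m ++ M) n.
  move=> nk; apply/reaches_bulbs_sockets => //; apply: Or41.
  by exists n => //; apply: gb; lia.
have [km|km] := boolP ((0 < k) && (m == 1)); last first.
  (* As [twist] is an involution, moves inside [M] reach [k + j] exactly when [M] reaches
     [twist k m j]; this covers protection by carry-on moves as well. *)
  have valE h j : obind (bulbs_sockets_value k m) h = finite (k + j) <->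
      h = finite (twist k m j).
    case: h => [h|] //=; rewrite /bulbs_sockets_value andbA (negbTE km) /=.
    split=> -[]; first by move/addnI <-; rewrite twistK.
    by move=> ->; rewrite twistK.
  have E j : reaches (bulbs k ++ sockets m ++ M) (k + j) <->
      reaches M (twist k m j) \/
      0 < m /\ obind (bulbs_sockets_value k m.-1) (grundy M) = finite (k + j).
    rewrite reaches_bulbs_sockets // andbA (negbTE km) /=; split.
      case=> [[i ik]|[m0]|[M' mv]|[M' mv]].
      - by rewrite gb => [[]|]; lia.
      - by rewrite IHp //; right.
      - by rewrite IHq // valE => vM; left; left; exists M'.
      - by rewrite IHc // valE => vM; left; right; exists M'.
    case=> [[[M' mv]|[M' mv]]|[m0]].
    - by move/valE => vM; apply: Or43; exists M'; rewrite ?IHq.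
    - by move=> vM; apply: Or44; exists M'; rewrite ?IHc ?valE.
    - by rewrite -IHp // => vM; apply: Or42.
  case vM: (grundy M) => [g|] /=; last first.
    apply/grundy_infiniteP => n; have [/low //|kn] := ltnP n k.
    rewrite -(subnKC kn); apply/E; left.
    by move/grundy_infiniteP: vM; apply.
  have [ng lg] := proj1 (grundy_finiteP _ _) vM.
  rewrite /bulbs_sockets_value andbA (negbTE km) /=.
  apply/grundy_finiteP; split.
    case/E; first by rewrite twistK.
    by rewrite vM => -[m0]; exact: twist_pred_neq.
  move=> n; have [/low //|kn] := ltnP n k.
  rewrite -(subnKC kn) ltn_add2l => /(twist_below km) nb; apply/E.
  by rewrite vM; case: nb => [/lg|]; [left|right].
move: km => /andP [k0 /eqP m1]; subst m.
case nM: (nilp M).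
  move: nM => /nilP ->; rewrite grundy_nil cats0 grundy_bulbs_socket.
    by rewrite /= /bulbs_sockets_value !andbF /twist k0 /= addn1.
  by move=> i ik; apply: gb; lia.
have sM : starts_with_bulb M by apply/starts_with_bulb_nilp; rewrite ?nM.
(* The lone socket now lies between two bulbs; its carry-on move protects every value except that of
   [bulbs k ++ M]. *)
have E n : grundy (bulbs k ++ M) <> finite n ->
    reaches (bulbs k ++ sockets 1 ++ M) n.
  by move=> ?; apply/reaches_bulbs_sockets => //; apply: Or42; rewrite k0 nM.
have val0 h : bulbs_sockets_value k 0 h = finite (k + h).
  by rewrite /bulbs_sockets_value /twist /= !andbF.
have val1 h : bulbs_sockets_value k 1 h = if h == 1 then infinite else
    finite (k + if h == 0 then 1 else h).
  rewrite /bulbs_sockets_value /twist k0 /=.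
  by case: h => [|[|h]].
move: (IHp isT); rewrite [sockets _]/= cat0s => IHp'.
case vM: (grundy M) IHp' => [g|] /= IHp'; last first.
  by apply/grundy_infiniteP => n; apply: E; rewrite IHp'.
rewrite -[Socket :: M]/(sockets 1 ++ M) val1; rewrite val0 in IHp'.
have [ng lg] := proj1 (grundy_finiteP _ _) vM.
(* Deleting all of [M] is a quiet move to a word of value 0. *)
have g0 : g <> 0.
  by move=> g0; apply: ng; rewrite g0; exact: starts_with_bulb_reaches0.
have [g1|g1] := eqVneq g 1.
  apply/grundy_infiniteP => n; have [->|nk] := eqVneq n k.+1; last first.
    by apply: E; rewrite IHp' g1 addn1 => -[/esym]; apply/eqP.
  (* The one unprotected value [k.+1] is attained by deleting all of [M], which leaves [k] bulbs and
     a socket. *)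
  apply/reaches_bulbs_sockets => //; apply: Or43; exists [::].
    exact: starts_with_bulb_quiet_nil.
  rewrite cats0 grundy_bulbs_socket // => i ik.
  by apply: gb; lia.
(* Here [g] is at least 2, whereas 0 is sent to [k + 1] and 1 to infinity, so no value other than
   [g] is sent to [k + g]. Hence moves inside [M] miss [k + g], the one value left unprotected. *)
have V h : obind (bulbs_sockets_value k 1) h = finite (k + g) <-> h = finite g.
  case: h => [h|] //=; rewrite val1.
  case: eqP => [->|h1]; first by split=> // -[] ?; lia.
  by case: eqP => h0; split=> -[] ?; congr Some; lia.
case: (g =P 0) => // _.
apply/grundy_finiteP; split=> [|n ltn]; last first.
  by apply: E; rewrite IHp' => -[]; lia.
case/reaches_bulbs_sockets => // [[i ik]|[_]|[M' mv]|[M' mv]].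
- by rewrite gb => [[]|]; lia.
- by rewrite k0 nM /= IHp'.
- by rewrite IHq // V => vM'; apply: ng; left; exists M'.
- by rewrite IHc // V => vM'; apply: ng; right; exists M'.
Qed.

Theorem theorem9 (k m : nat) (M : component)
  (hM : starts_with_bulb M) (hG : grundy M = infinite) :
  grundy (bulbs k ++ sockets m ++ M) = infinite.
Proof. by rewrite grundy_bulbs_sockets ?hG //; right. Qed.
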